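(* The synchronous subtyping relation $\le_s$ is complete for the synchronous session calculus: for all closed session types $T,S$, if there do not exist an evaluation context $C$ and a process $P$ such that $\vdash_s C[a:S]\triangleright\emptyset$, $\vdash_s P\triangleright\{a:T\}$ and $C[P]\to_s^*\mathtt{error}$, then $T\le_s S$.
   Context: Synchronous session calculus. There are countable sets of channel variables $x,y,z,\ldots$, linear channels $a,b,c,d,\ldots$, labels $l,l_i,\ldots$ and process variables $X,Y,\ldots$; identifiers are $u ::= a \mid x$. Processes are $P ::= \mathbf 0 \mid X\langle\tilde u\rangle \mid \sum_{i\in I} u?l_i(x_i).P_i \mid u!l\langle u'\rangle.P \mid P\,|\,P \mid P\oplus P \mid \mathbf{def}\ X(\tilde x)=P\ \mathbf{in}\ P \mid (\nu ab)P \mid \mathtt{error}$, where in an input the labels $l_i$ are pairwise distinct, and recursion is guarded (in a declaration $D$ of the form $X(\tilde x)=P$, process variables occur in $P$ only under an input or output prefix). Binders: $x_i$ in inputs, $\tilde x$ and $X$ in definitions, and $a,b$ in $(\nu ab)P$ (which makes $a,b$ co-channels); processes are considered up to $\alpha$-conversion, bound names distinct from free ones. $\mathrm{fc}(P)$ is the set of free linear channels of $P$; the free subject channels are $\mathrm{sc}(u!l\langle u'\rangle.P)=\mathrm{fc}(u)\cup\mathrm{sc}(P)$, $\mathrm{sc}(\sum_i u?l_i(x_i).P_i)=\mathrm{fc}(u)\cup\bigcup_i\mathrm{sc}(P_i)$, $\mathrm{sc}(\mathbf{def}\ D\ \mathbf{in}\ P)=\mathrm{sc}(P)$, where $\mathrm{fc}(x)=\emptyset$,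 $\mathrm{fc}(a)=\{a\}$, and $\mathrm{sc}$ is defined structurally on the other constructors (union over components of $|$ and $\oplus$, removing $a,b$ under $(\nu ab)$, empty for $\mathbf 0$, process calls and $\mathtt{error}$). Structural congruence $\equiv$ is the least congruence with: $\mathbf 0|P\equiv P$; $|$ and $\oplus$ commutative and associative; $(\nu ab)\mathbf 0\equiv\mathbf 0$; $((\nu ab)P)|Q\equiv(\nu ab)(P|Q)$; $(\nu ab)(\nu cd)P\equiv(\nu cd)(\nu ab)P$; $\mathbf{def}\ D\ \mathbf{in}\ \mathbf 0\equiv\mathbf 0$; $\mathbf{def}\ D\ \mathbf{in}\ (\nu ab)P\equiv(\nu ab)(\mathbf{def}\ D\ \mathbf{in}\ P)$; $(\mathbf{def}\ D\ \mathbf{in}\ P)|Q\equiv\mathbf{def}\ D\ \mathbf{in}\ (P|Q)$; $\mathbf{def}\ D\ \mathbf{in}\ \mathbf{def}\ D'\ \mathbf{in}\ P\equiv\mathbf{def}\ D'\ \mathbf{in}\ \mathbf{def}\ D\ \mathbf{in}\ P$. Evaluation contexts: $C ::= [\,] \mid C|P \mid (\nu ab)C \mid \mathbf{def}\ D\ \mathbf{in}\ C$. The reduction $\to_s$ is the least relation closed under: $(\nu ab)(a!l_k\langle c\rangle.P \mid \sum_{i\in I} b?l_i(x_i).Q_i)\to(\nu ab)(P\mid Q_k\{c/x_k\})$ if $k\in I$; $\mathbf{def}\ X(\tilde x)=P\ \mathbf{in}\ (X\langle\tilde a\rangle\mid Q)\to\mathbf{def}\ X(\tilde x)=P\ \mathbf{in}\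 (P\{\tilde a/\tilde x\}\mid Q)$; $P\oplus Q\to P$; $P\to P'$ implies $C[P]\to C[P']$; $P\equiv P'\to Q'\equiv Q$ implies $P\to Q$; and the error rules: $(\nu ab)(a!l\langle c\rangle.P\mid\sum_{i\in I}b?l_i(x_i).Q_i)\to\mathtt{error}$ if $l\neq l_i$ for all $i\in I$; $(\nu ab)P\to\mathtt{error}$ if $a\in\mathrm{sc}(P)$ and $b\notin\mathrm{fc}(P)$; $(\nu ab)(a!l\langle c\rangle.P\mid b!l'\langle c'\rangle.Q)\to\mathtt{error}$; $(\nu ab)(\sum_{i\in I}a?l_i(x_i).P_i\mid\sum_{j\in J}b?l'_j(x'_j).Q_j)\to\mathtt{error}$; $C[\mathtt{error}]\to\mathtt{error}$. $\to_s^*$ is its reflexive-transitive closure. Session types: $T,S ::= \&_{i\in I}?l_i(S_i).T_i \mid \bigoplus_{i\in I}!l_i\langle S_i\rangle.T_i \mid \mathbf t \mid \mu\mathbf t.T \mid \mathsf{end}$, with pairwise distinct labels in each branching/selection, closed exchanged types $S_i$ and contractive recursion; types are equi-recursive (identified when they have the same regular tree, so $\mu\mathbf t.T=T\{\mu\mathbf t.T/\mathbf t\}$). Duality $\overline T$: $\overline{\&_i ?l_i(S_i).T_i}=\bigoplus_i!l_i\langle S_i\rangle.\overline{T_i}$, $\overline{\bigoplus_i!l_i\langle S_i\rangle.T_i}=\&_i?l_i(S_i).\overline{T_i}$, $\overline{\mathbf t}=\mathbf t$, $\overline{\mu\mathbf t.T}=\mu\mathbf t.\overline T$, $\overline{\mathsf{end}}=\mathsf{end}$.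 Synchronous subtyping $\le_s$ is the largest relation on closed types such that $T\le_s S$ implies one of: $T=S=\mathsf{end}$; $T=\&_{i\in I\cup J}?l_i(S_i).T_i$, $S=\&_{i\in I}?l_i(S'_i).T'_i$ with $S_i\le_s S'_i$ and $T_i\le_s T'_i$ for all $i\in I$; $T=\bigoplus_{i\in I}!l_i\langle S_i\rangle.T_i$, $S=\bigoplus_{i\in I\cup J}!l_i\langle S'_i\rangle.T'_i$ with $S'_i\le_s S_i$ and $T_i\le_s T'_i$ for all $i\in I$. Typing: shared environments $\Gamma ::= \emptyset\mid\Gamma,X:\tilde T$; session environments $\Delta ::= \emptyset\mid\Delta,u:T$ ($\Delta_1,\Delta_2$ denotes union of environments with disjoint domains). $\Delta_1\le_s\Delta_2$ means $\Delta_1(u)\le_s\Delta_2(u)$ for $u$ in both domains and $\Delta_i(u)=\mathsf{end}$ for $u$ in only one domain. $\Gamma\vdash_s P\triangleright\Delta$ is derived by: from $\Gamma\vdash_s P\triangleright\Delta$ and $\Delta\le_s\Delta'$ infer $\Gamma\vdash_s P\triangleright\Delta'$; $\Gamma\vdash_s\mathbf 0\triangleright\emptyset$; $\Gamma,X:\tilde T\vdash_s X\langle\tilde u\rangle\triangleright\{\tilde u:\tilde T\}$; if $\Gamma\vdash_s P_i\triangleright\Delta,u:T_i,x_i:S_i$ for all $i\in I$ then $\Gamma\vdash_s\sum_{i\in I}u?l_i(x_i).P_i\triangleright\Delta,u:\&_{i\in I}?l_i(S_i).T_i$; if $\Gamma\vdash_s P\triangleright\Delta,u:T$ then $\Gamma\vdash_s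 u!l\langle u'\rangle.P\triangleright\Delta,u:!l\langle S\rangle.T,u':S$; if $\Gamma\vdash_s P_1\triangleright\Delta_1$ and $\Gamma\vdash_s P_2\triangleright\Delta_2$ then $\Gamma\vdash_s P_1|P_2\triangleright\Delta_1,\Delta_2$; if $\Gamma\vdash_s P_1\triangleright\Delta$ and $\Gamma\vdash_s P_2\triangleright\Delta$ then $\Gamma\vdash_s P_1\oplus P_2\triangleright\Delta$; if $\Gamma,X:\tilde T\vdash_s P\triangleright\{\tilde x:\tilde T\}$ and $\Gamma,X:\tilde T\vdash_s Q\triangleright\Delta$ then $\Gamma\vdash_s\mathbf{def}\ X(\tilde x)=P\ \mathbf{in}\ Q\triangleright\Delta$; if $\Gamma\vdash_s P\triangleright\Delta,a:T,b:\overline T$ then $\Gamma\vdash_s(\nu ab)P\triangleright\Delta$. No rule types $\mathtt{error}$. $\vdash_s P\triangleright\Delta$ means $\emptyset\vdash_s P\triangleright\Delta$. For an evaluation context $C$, $\vdash_s C[a:S]\triangleright\emptyset$ means $X:S\vdash_s C[X\langle a\rangle]\triangleright\emptyset$ for a process variable $X$ not occurring in $C$.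
   Formalization: Structural congruence also includes (νab)P ≡ (νba)P, without which completeness fails (e.g. T = !l⟨end⟩.?l1(end).end, S = !l⟨end⟩.?l2(end).end); index sets of input sums, branchings and selections are non-empty. *)

(* Defs.v *)
From Stdlib Require Export List PeanoNat Relations FinFun.
Export ListNotations.

Definition label := nat.
Definition chan := nat.
Definition var := nat.
Definition pvar := nat.
Definition tvar := nat.

(* A branch [(l, S, T)] of [TBra] is [?l(S).T], one of [TSel] is [!l<S>.T]. *)
Inductive styp : Type :=
| TEnd
| TVar (t : tvar)
| TMu (t : tvar) (T : styp)
| TBra (bs : list (label * styp * styp))
| TSel (bs : list (label * styp * styp)).

Definition br_label (b : label * styp * styp) : label := fst (fst b).

(* [t] does not occur in [T] at the root, up to leading [TMu]s. *)
Fixpoint contractive_in (t : tvar) (T : styp) : Prop :=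
  match T with
  | TVar s => s <> t
  | TMu s T => s = t \/ contractive_in t T
  | TEnd | TBra _ | TSel _ => True
  end.

(* Well-formed types with free variables among [ts].  Branchings and
   selections (like input sums, see [wf_proc]) have a non-empty index set:
   an empty input sum would inhabit every session environment. *)
Inductive wf_styp : list tvar -> styp -> Prop :=
| wf_end ts : wf_styp ts TEnd
| wf_var ts t : In t ts -> wf_styp ts (TVar t)
| wf_mu ts t T :
    wf_styp (t :: ts) T -> contractive_in t T -> wf_styp ts (TMu t T)
| wf_bra ts bs :
    bs <> [] -> NoDup (map br_label bs) ->
    (forall l S T, In (l, S, T) bs -> wf_styp [] S) ->
    (forall l S T, In (l, S, T) bs -> wf_styp ts T) ->
    wf_styp ts (TBra bs)
| wf_sel ts bs :
    bs <> [] -> NoDup (map br_label bs) ->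
    (forall l S T, In (l, S, T) bs -> wf_styp [] S) ->
    (forall l S T, In (l, S, T) bs -> wf_styp ts T) ->
    wf_styp ts (TSel bs).

Definition closed_styp (T : styp) : Prop := wf_styp [] T.

(* Exchanged types are closed, hence not affected.  The substitution is only
   used with a closed [U], so that no variable can be captured. *)
Fixpoint tsubst (t : tvar) (U T : styp) : styp :=
  match T with
  | TEnd => TEnd
  | TVar s => if Nat.eq_dec s t then U else TVar s
  | TMu s T => if Nat.eq_dec s t then TMu s T else TMu s (tsubst t U T)
  | TBra bs => TBra (map (fun '(l, V, T) => (l, V, tsubst t U T)) bs)
  | TSel bs => TSel (map (fun '(l, V, T) => (l, V, tsubst t U T)) bs)
  end.

Fixpoint dual (T : styp) : styp :=
  match T with
  | TEnd => TEnd
  | TVar t => TVar t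
  | TMu t T => TMu t (dual T)
  | TBra bs => TSel (map (fun '(l, V, T) => (l, V, dual T)) bs)
  | TSel bs => TBra (map (fun '(l, V, T) => (l, V, dual T)) bs)
  end.

(* [unfolds T T']: [T'] is obtained by unfolding the leading [TMu]s of [T]. *)
Inductive unfolds : styp -> styp -> Prop :=
| unf_end : unfolds TEnd TEnd
| unf_bra bs : unfolds (TBra bs) (TBra bs)
| unf_sel bs : unfolds (TSel bs) (TSel bs)
| unf_mu t T T' : unfolds (tsubst t (TMu t T) T) T' -> unfolds (TMu t T) T'.

Definition branches_rel (R : styp -> styp -> Prop)
    (bs bs' : list (label * styp * styp)) : Prop :=
  (forall l S T, In (l, S, T) bs ->
     exists S' T', In (l, S', T') bs' /\ R S S' /\ R T T') /\
  (forall l S' T', In (l, S', T') bs' ->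
     exists S T, In (l, S, T) bs /\ R S S' /\ R T T').

Definition tree_bisim (R : styp -> styp -> Prop) : Prop :=
  forall T S, R T S ->
    closed_styp T /\ closed_styp S /\
    exists T' S', unfolds T T' /\ unfolds S S' /\
      match T', S' with
      | TEnd, TEnd => True
      | TBra bs, TBra bs' => branches_rel R bs bs'
      | TSel bs, TSel bs' => branches_rel R bs bs'
      | _, _ => False
      end.

(* Equality of equi-recursive types: [T] and [S] are closed types with the same
   (possibly infinite) tree, where the branches of a node are unordered. *)
Definition teq (T S : styp) : Prop :=
  exists R, tree_bisim R /\ R T S.

Definition sub_sim (R : styp -> styp -> Prop) : Prop :=
  forall T S, R T S ->
    closed_styp T /\ closed_styp S /\
    ((teq T TEnd /\ teq S TEnd)
     \/ (exists bs bs', teq T (TBra bs) /\ teq S (TBra bs') /\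
           forall l S1' T1', In (l, S1', T1') bs' ->
             exists S1 T1, In (l, S1, T1) bs /\ R S1 S1' /\ R T1 T1')
     \/ (exists bs bs', teq T (TSel bs) /\ teq S (TSel bs') /\
           forall l S1 T1, In (l, S1, T1) bs ->
             exists S1' T1', In (l, S1', T1') bs' /\ R S1' S1 /\ R T1 T1')).

Definition subtype_s (T S : styp) : Prop :=
  exists R, sub_sim R /\ R T S.

Inductive ident : Type :=
| Chan (a : chan)
| Var (x : var).

(* A branch [(l, x, P)] of [PIn u] is [u?l(x).P].
   [PDef X xs P Q] is [def X(xs) = P in Q]. *)
Inductive proc : Type :=
| PNil
| PCall (X : pvar) (us : list ident)
| PIn (u : ident) (bs : list (label * var * proc))
| POut (u : ident) (l : label) (u' : ident) (P : proc)
| PPar (P Q : proc)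
| PChoice (P Q : proc)
| PDef (X : pvar) (xs : list var) (P Q : proc)
| PRes (a b : chan) (P : proc)
| PErr.

Definition in_label (b : label * var * proc) : label := fst (fst b).

Inductive ctx : Type :=
| CHole
| CPar (C : ctx) (P : proc)
| CRes (a b : chan) (C : ctx)
| CDef (X : pvar) (xs : list var) (P : proc) (C : ctx).

(* Names of [P] may be captured by the binders of [C]. *)
Fixpoint fill (C : ctx) (P : proc) : proc :=
  match C with
  | CHole => P
  | CPar C Q => PPar (fill C P) Q
  | CRes a b C => PRes a b (fill C P)
  | CDef X xs D C => PDef X xs D (fill C P)
  end.

(* No process variable occurs outside an input or output prefix. *)
Fixpoint guarded (P : proc) : Prop :=
  match P with
  | PNil | PErr | PIn _ _ | POut _ _ _ _ => True
  | PCall _ _ => False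
  | PPar P Q | PChoice P Q => guarded P /\ guarded Q
  | PDef _ _ P Q => guarded P /\ guarded Q
  | PRes _ _ P => guarded P
  end.

Inductive wf_proc : proc -> Prop :=
| wfp_nil : wf_proc PNil
| wfp_call X us : wf_proc (PCall X us)
| wfp_in u bs :
    bs <> [] -> NoDup (map in_label bs) ->
    (forall l x P, In (l, x, P) bs -> wf_proc P) ->
    wf_proc (PIn u bs)
| wfp_out u l u' P : wf_proc P -> wf_proc (POut u l u' P)
| wfp_par P Q : wf_proc P -> wf_proc Q -> wf_proc (PPar P Q)
| wfp_choice P Q : wf_proc P -> wf_proc Q -> wf_proc (PChoice P Q)
| wfp_def X xs P Q :
    NoDup xs -> guarded P -> wf_proc P -> wf_proc Q ->
    wf_proc (PDef X xs P Q)
| wfp_res a b P : a <> b -> wf_proc P -> wf_proc (PRes a b P)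
| wfp_err : wf_proc PErr.

Fixpoint wf_ctx (C : ctx) : Prop :=
  match C with
  | CHole => True
  | CPar C P => wf_ctx C /\ wf_proc P
  | CRes a b C => a <> b /\ wf_ctx C
  | CDef _ xs P C => NoDup xs /\ guarded P /\ wf_proc P /\ wf_ctx C
  end.

Definition ident_chans (u : ident) : list chan :=
  match u with Chan a => [a] | Var _ => [] end.

Definition ident_vars (u : ident) : list var :=
  match u with Chan _ => [] | Var x => [x] end.

Definition remove_all (xs l : list nat) : list nat :=
  filter (fun x => negb (existsb (Nat.eqb x) xs)) l.

Fixpoint fc (P : proc) : list chan :=
  match P with
  | PNil | PErr => []
  | PCall _ us => flat_map ident_chans us
  | PIn u bs => ident_chans u ++ flat_map (fun '(_, _, P) => fc P) bs
  | POut u _ u' P => ident_chans u ++ ident_chans u' ++ fc P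
  | PPar P Q | PChoice P Q | PDef _ _ P Q => fc P ++ fc Q
  | PRes a b P => remove_all [a; b] (fc P)
  end.

Fixpoint sc (P : proc) : list chan :=
  match P with
  | PNil | PErr | PCall _ _ => []
  | PIn u bs => ident_chans u ++ flat_map (fun '(_, _, P) => sc P) bs
  | POut u _ _ P => ident_chans u ++ sc P
  | PPar P Q | PChoice P Q => sc P ++ sc Q
  | PDef _ _ _ Q => sc Q
  | PRes a b P => remove_all [a; b] (sc P)
  end.

Fixpoint bound_chans (P : proc) : list chan :=
  match P with
  | PNil | PErr | PCall _ _ => []
  | PIn _ bs => flat_map (fun '(_, _, P) => bound_chans P) bs
  | POut _ _ _ P => bound_chans P
  | PPar P Q | PChoice P Q | PDef _ _ P Q => bound_chans P ++ bound_chans Q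
  | PRes a b P => a :: b :: bound_chans P
  end.

Fixpoint fv (P : proc) : list var :=
  match P with
  | PNil | PErr => []
  | PCall _ us => flat_map ident_vars us
  | PIn u bs => ident_vars u ++ flat_map (fun '(_, x, P) => remove_all [x] (fv P)) bs
  | POut u _ u' P => ident_vars u ++ ident_vars u' ++ fv P
  | PPar P Q | PChoice P Q => fv P ++ fv Q
  | PDef _ xs P Q => remove_all xs (fv P) ++ fv Q
  | PRes _ _ P => fv P
  end.

Fixpoint fpv (P : proc) : list pvar :=
  match P with
  | PNil | PErr => []
  | PCall X _ => [X]
  | PIn _ bs => flat_map (fun '(_, _, P) => fpv P) bs
  | POut _ _ _ P => fpv P
  | PPar P Q | PChoice P Q => fpv P ++ fpv Q
  | PDef X _ P Q => remove_all [X] (fpv P ++ fpv Q)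
  | PRes _ _ P => fpv P
  end.

(* All process variables, free, bound or binding. *)
Fixpoint pvars (P : proc) : list pvar :=
  match P with
  | PNil | PErr => []
  | PCall X _ => [X]
  | PIn _ bs => flat_map (fun '(_, _, P) => pvars P) bs
  | POut _ _ _ P => pvars P
  | PPar P Q | PChoice P Q => pvars P ++ pvars Q
  | PDef X _ P Q => X :: pvars P ++ pvars Q
  | PRes _ _ P => pvars P
  end.

Fixpoint pvars_ctx (C : ctx) : list pvar :=
  match C with
  | CHole => []
  | CPar C P => pvars_ctx C ++ pvars P
  | CRes _ _ C => pvars_ctx C
  | CDef X _ P C => X :: pvars P ++ pvars_ctx C
  end.

Definition rename_ident (f : chan -> chan) (g : var -> var) (u : ident) : ident :=
  match u with Chan a => Chan (f a) | Var x => Var (g x) end.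

Fixpoint rename (f : chan -> chan) (g : var -> var) (h : pvar -> pvar)
    (P : proc) : proc :=
  match P with
  | PNil => PNil
  | PCall X us => PCall (h X) (map (rename_ident f g) us)
  | PIn u bs =>
      PIn (rename_ident f g u) (map (fun '(l, x, P) => (l, g x, rename f g h P)) bs)
  | POut u l u' P =>
      POut (rename_ident f g u) l (rename_ident f g u') (rename f g h P)
  | PPar P Q => PPar (rename f g h P) (rename f g h Q)
  | PChoice P Q => PChoice (rename f g h P) (rename f g h Q)
  | PDef X xs P Q => PDef (h X) (map g xs) (rename f g h P) (rename f g h Q)
  | PRes a b P => PRes (f a) (f b) (rename f g h P)
  | PErr => PErr
  end.

Inductive congr (B : proc -> proc -> Prop) : proc -> proc -> Prop :=
| congr_base P Q : B P Q -> congr B P Q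
| congr_refl P : congr B P P
| congr_sym P Q : congr B P Q -> congr B Q P
| congr_trans P Q R : congr B P Q -> congr B Q R -> congr B P R
| congr_in u bs1 l x P P' bs2 :
    congr B P P' ->
    congr B (PIn u (bs1 ++ (l, x, P) :: bs2)) (PIn u (bs1 ++ (l, x, P') :: bs2))
| congr_out u l u' P P' :
    congr B P P' -> congr B (POut u l u' P) (POut u l u' P')
| congr_par P P' Q Q' :
    congr B P P' -> congr B Q Q' -> congr B (PPar P Q) (PPar P' Q')
| congr_choice P P' Q Q' :
    congr B P P' -> congr B Q Q' -> congr B (PChoice P Q) (PChoice P' Q')
| congr_def X xs P P' Q Q' :
    congr B P P' -> congr B Q Q' -> congr B (PDef X xs P Q) (PDef X xs P' Q')
| congr_res a b P P' :
    congr B P P' -> congr B (PRes a b P) (PRes a b P').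

(* Alpha-conversion is generated by the injective renamings of all the names of
   a process which fix its free names.  For instance, exchanging [a] with a
   channel [c] that is not free in [(nu a b)P] renames the binder [a] to [c]. *)
Inductive alpha_base : proc -> proc -> Prop :=
| alpha_rename f g h P :
    Injective f -> Injective g -> Injective h ->
    (forall a, In a (fc P) -> f a = a) ->
    (forall x, In x (fv P) -> g x = x) ->
    (forall X, In X (fpv P) -> h X = X) ->
    alpha_base P (rename f g h P).

Definition alpha : proc -> proc -> Prop := congr alpha_base.

(* The side conditions on names spell out the convention that bound names are
   distinct from the free ones.  The two co-channels of a restriction play
   symmetric roles ([sc_res_sym]): the reduction rules are stated with the output
   on the first one only, whereas the direction of a session changes over time. *)
Inductive scong_base : proc -> proc -> Prop :=
| sc_alpha P Q : alpha_base P Q -> scong_base P Q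
| sc_par_nil P : scong_base (PPar PNil P) P
| sc_par_comm P Q : scong_base (PPar P Q) (PPar Q P)
| sc_par_assoc P Q R : scong_base (PPar (PPar P Q) R) (PPar P (PPar Q R))
| sc_choice_comm P Q : scong_base (PChoice P Q) (PChoice Q P)
| sc_choice_assoc P Q R :
    scong_base (PChoice (PChoice P Q) R) (PChoice P (PChoice Q R))
| sc_res_sym a b P : scong_base (PRes a b P) (PRes b a P)
| sc_res_nil a b : a <> b -> scong_base (PRes a b PNil) PNil
| sc_res_par a b P Q :
    ~ In a (fc Q) -> ~ In b (fc Q) ->
    scong_base (PPar (PRes a b P) Q) (PRes a b (PPar P Q))
| sc_res_res a b c d P :
    a <> c -> a <> d -> b <> c -> b <> d ->
    scong_base (PRes a b (PRes c d P)) (PRes c d (PRes a b P))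
| sc_def_nil X xs D :
    wf_proc (PDef X xs D PNil) -> scong_base (PDef X xs D PNil) PNil
| sc_def_res X xs D a b P :
    ~ In a (fc D) -> ~ In b (fc D) ->
    scong_base (PDef X xs D (PRes a b P)) (PRes a b (PDef X xs D P))
| sc_def_par X xs D P Q :
    ~ In X (fpv Q) ->
    scong_base (PPar (PDef X xs D P) Q) (PDef X xs D (PPar P Q))
| sc_def_def X xs D Y ys E P :
    X <> Y -> ~ In X (fpv E) -> ~ In Y (fpv D) ->
    scong_base (PDef X xs D (PDef Y ys E P)) (PDef Y ys E (PDef X xs D P)).

Definition scong : proc -> proc -> Prop := congr scong_base.

Fixpoint assoc (s : list (var * chan)) (x : var) : option chan :=
  match s with
  | [] => None
  | (y, c) :: s => if Nat.eq_dec x y then Some c else assoc s x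
  end.

Definition subst_ident (s : list (var * chan)) (u : ident) : ident :=
  match u with
  | Chan a => Chan a
  | Var x => match assoc s x with Some c => Chan c | None => Var x end
  end.

Definition drop_vars (xs : list var) (s : list (var * chan)) : list (var * chan) :=
  filter (fun p => negb (existsb (Nat.eqb (fst p)) xs)) s.

(* Simultaneous substitution of channels for free variables; it avoids capture
   when these channels are not in [bound_chans P]. *)
Fixpoint subst (s : list (var * chan)) (P : proc) : proc :=
  match P with
  | PNil => PNil
  | PCall X us => PCall X (map (subst_ident s) us)
  | PIn u bs =>
      PIn (subst_ident s u)
        (map (fun '(l, x, P) => (l, x, subst (drop_vars [x] s) P)) bs)
  | POut u l u' P => POut (subst_ident s u) l (subst_ident s u') (subst s P)
  | PPar P Q => PPar (subst s P) (subst s Q)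
  | PChoice P Q => PChoice (subst s P) (subst s Q)
  | PDef X xs P Q => PDef X xs (subst (drop_vars xs s) P) (subst s Q)
  | PRes a b P => PRes a b (subst s P)
  | PErr => PErr
  end.

(* In [red_com] and [red_call], [bound_chans] excludes capture; the conditions
   can always be met by [scong], which contains alpha-conversion. *)
Inductive red_s : proc -> proc -> Prop :=
| red_com a b c l P x Q bs :
    In (l, x, Q) bs -> ~ In c (bound_chans Q) ->
    red_s (PRes a b (PPar (POut (Chan a) l (Chan c) P) (PIn (Chan b) bs)))
          (PRes a b (PPar P (subst [(x, c)] Q)))
| red_call X xs P cs Q :
    length cs = length xs ->
    (forall c, In c cs -> ~ In c (bound_chans P)) ->
    red_s (PDef X xs P (PPar (PCall X (map Chan cs)) Q))
          (PDef X xs P (PPar (subst (combine xs cs) P) Q))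
| red_choice P Q : red_s (PChoice P Q) P
| red_ctx C P P' : red_s P P' -> red_s (fill C P) (fill C P')
| red_scong P P' Q' Q :
    scong P P' -> red_s P' Q' -> scong Q' Q -> red_s P Q
| red_err_label a b l c P bs :
    ~ In l (map in_label bs) ->
    red_s (PRes a b (PPar (POut (Chan a) l (Chan c) P) (PIn (Chan b) bs))) PErr
| red_err_orphan a b P :
    In a (sc P) -> ~ In b (fc P) -> red_s (PRes a b P) PErr
| red_err_out a b l c P l' c' Q :
    red_s (PRes a b (PPar (POut (Chan a) l (Chan c) P)
                          (POut (Chan b) l' (Chan c') Q))) PErr
| red_err_in a b bs bs' :
    red_s (PRes a b (PPar (PIn (Chan a) bs) (PIn (Chan b) bs'))) PErr
| red_err_ctx C : red_s (fill C PErr) PErr.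

Definition reds_s : proc -> proc -> Prop := clos_refl_trans proc red_s.

Definition shenv := list (pvar * list styp).
Definition senv := list (ident * styp).

Definition wf_senv (Delta : senv) : Prop :=
  NoDup (map fst Delta) /\ forall u T, In (u, T) Delta -> closed_styp T.

Definition senv_sub (Delta1 Delta2 : senv) : Prop :=
  (forall u T S, In (u, T) Delta1 -> In (u, S) Delta2 -> subtype_s T S) /\
  (forall u T, In (u, T) Delta1 -> ~ In u (map fst Delta2) -> teq T TEnd) /\
  (forall u T, In (u, T) Delta2 -> ~ In u (map fst Delta1) -> teq T TEnd).

(* [wf_senv] holds of all the session environments in a derivation; in
   particular it makes the domains in [Delta, u : T] and [Delta1, Delta2]
   disjoint.  Session environments are unordered and their types are taken up to
   [teq], by [ty_sub].  Processes are typed up to alpha-conversion. *)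
Inductive typed : shenv -> proc -> senv -> Prop :=
| ty_alpha Gamma P P' Delta :
    alpha P P' -> typed Gamma P Delta -> typed Gamma P' Delta
| ty_sub Gamma P Delta Delta' :
    typed Gamma P Delta -> senv_sub Delta Delta' -> wf_senv Delta' ->
    typed Gamma P Delta'
| ty_nil Gamma : typed Gamma PNil []
| ty_call Gamma X Ts us :
    In (X, Ts) Gamma -> length us = length Ts -> wf_senv (combine us Ts) ->
    typed Gamma (PCall X us) (combine us Ts)
| ty_in Gamma Delta u bs ts :
    map in_label bs = map br_label ts ->
    (forall l x P S T, In (l, x, P) bs -> In (l, S, T) ts ->
       typed Gamma P ((Var x, S) :: (u, T) :: Delta)) ->
    wf_senv ((u, TBra ts) :: Delta) ->
    typed Gamma (PIn u bs) ((u, TBra ts) :: Delta)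
| ty_out Gamma Delta u l u' P S T :
    typed Gamma P ((u, T) :: Delta) ->
    wf_senv ((u, TSel [(l, S, T)]) :: (u', S) :: Delta) ->
    typed Gamma (POut u l u' P) ((u, TSel [(l, S, T)]) :: (u', S) :: Delta)
| ty_par Gamma P1 P2 Delta1 Delta2 :
    typed Gamma P1 Delta1 -> typed Gamma P2 Delta2 ->
    wf_senv (Delta1 ++ Delta2) ->
    typed Gamma (PPar P1 P2) (Delta1 ++ Delta2)
| ty_choice Gamma P1 P2 Delta :
    typed Gamma P1 Delta -> typed Gamma P2 Delta ->
    typed Gamma (PChoice P1 P2) Delta
| ty_def Gamma X xs Ts P Q Delta :
    ~ In X (map fst Gamma) -> length xs = length Ts ->
    typed ((X, Ts) :: Gamma) P (combine (map Var xs) Ts) ->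
    typed ((X, Ts) :: Gamma) Q Delta ->
    typed Gamma (PDef X xs P Q) Delta
| ty_res Gamma a b T P Delta :
    typed Gamma P ((Chan a, T) :: (Chan b, dual T) :: Delta) ->
    typed Gamma (PRes a b P) Delta.

Definition ctx_typed (C : ctx) (a : chan) (S : styp) : Prop :=
  exists X, ~ In X (pvars_ctx C) /\
    typed [(X, [S])] (fill C (PCall X [Chan a])) [].

(* Main.v *)
(* If [T] is not a subtype of [S], there are processes [P] on [a : T] and [Q] on
   [b : dual S] such that [(nu ab)(P | Q)] reduces to [error]. Non-subtyping is
   witnessed along a finite path of communications, so the types need only be
   unfolded along it: elsewhere a diverging process [omega], which inhabits every
   session type, takes over. A selection is inhabited by sending the single label
   of the path, and the rest is left to subtyping. A mismatch between exchanged
   types moves the error to the session of the exchanged channel. Coinductively,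
   the pairs [(T, S)] such that [T] and [dual S] have no such processes form a
   subtyping simulation. *)

Require Import Defs.
From Stdlib Require Import Classical Lia.

(** * Well-formed types, substitution and unfolding *)

Lemma NoDup_map_inj {A B} (f : A -> B) l x y :
  NoDup (map f l) -> In x l -> In y l -> f x = f y -> x = y.
Proof.
  induction l as [|z l IH]; simpl; [tauto|].
  intros H Hx Hy E; inversion H as [|? ? Hz Hl]; subst.
  destruct Hx as [<-|Hx], Hy as [<-|Hy]; auto.
  - destruct Hz; rewrite E; apply in_map; auto.
  - destruct Hz; rewrite <- E; apply in_map; auto.
Qed.

Lemma wf_styp_incl ts ts' T : wf_styp ts T -> incl ts ts' -> wf_styp ts' T.
Proof.
  intros H; revert ts'; induction H; intros ts' Hi; constructor; auto.
  - apply IHwf_styp; intros s [->|Hs]; simpl; auto.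
  - intros; eapply H4; eauto.
  - intros; eapply H4; eauto.
Qed.

Lemma contractive_in_fresh ts s T : wf_styp ts T -> ~ In s ts -> contractive_in s T.
Proof.
  induction 1; simpl; intros Hs; auto.
  - intros ->; auto.
  - destruct (Nat.eq_dec t s); [auto|right].
    apply IHwf_styp; intros [E|E]; auto.
Qed.

Lemma contractive_in_tsubst s t U T :
  closed_styp U -> contractive_in s T -> contractive_in s (tsubst t U T).
Proof.
  intros HU; induction T; simpl; auto.
  - intros Hs; destruct Nat.eq_dec; auto.
    apply (contractive_in_fresh [] s U); auto.
  - intros [<-|Hs]; destruct Nat.eq_dec; simpl; auto.
Qed.

(** Allowing any [ts'] included in [t :: ts] lets the induction pass under a [TMu], which may shadow
    [t]; as [U] is closed, nothing is captured. *)
Lemma wf_styp_tsubst t ts ts' U T :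
  closed_styp U -> wf_styp ts' T -> incl ts' (t :: ts) -> wf_styp ts (tsubst t U T).
Proof.
  intros HU H; revert ts; induction H; intros ts' Hi; simpl.
  - constructor.
  - destruct Nat.eq_dec.
    + apply (wf_styp_incl []); [exact HU|intros ? []].
    + apply wf_var; destruct (Hi _ H); [congruence|auto].
  - destruct Nat.eq_dec as [->|n].
    + constructor; auto. apply (wf_styp_incl (t :: ts)); auto.
      intros s [->|Hs]; simpl; auto. apply Hi in Hs; exact Hs.
    + constructor.
      * apply IHwf_styp. intros s [->|Hs]; simpl; auto.
        apply Hi in Hs; destruct Hs; auto.
      * apply contractive_in_tsubst; auto.
  - constructor.
    + destruct bs; simpl; congruence.
    + rewrite map_map. erewrite map_ext; [exact H0|intros [[? ?] ?]; reflexivity].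
    + intros l S T Hin; apply in_map_iff in Hin as ([[l' S'] T'] & E & Hin).
      injection E as <- <- <-; eauto.
    + intros l S T Hin; apply in_map_iff in Hin as ([[l' S'] T'] & E & Hin).
      injection E as <- <- <-; eauto.
  - constructor.
    + destruct bs; simpl; congruence.
    + rewrite map_map. erewrite map_ext; [exact H0|intros [[? ?] ?]; reflexivity].
    + intros l S T Hin; apply in_map_iff in Hin as ([[l' S'] T'] & E & Hin).
      injection E as <- <- <-; eauto.
    + intros l S T Hin; apply in_map_iff in Hin as ([[l' S'] T'] & E & Hin).
      injection E as <- <- <-; eauto.
Qed.

Lemma closed_unfold t T : closed_styp (TMu t T) -> closed_styp (tsubst t (TMu t T) T).
Proof.
  intros H; inversion H; subst.
  apply (wf_styp_tsubst t [] [t]); auto using incl_refl.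
Qed.

Fixpoint mus (T : styp) : nat :=
  match T with TMu _ T => S (mus T) | _ => 0 end.

(** By contractiveness, either a leading [TMu] shadows [t] or [U] is inserted only below a prefix.
    Hence each unfolding removes exactly one leading [TMu], which is the termination measure of
    [unfolds_ex]. *)
Lemma mus_tsubst t U T : contractive_in t T -> mus (tsubst t U T) = mus T.
Proof.
  induction T; simpl; intros H; auto; destruct Nat.eq_dec; simpl; auto.
  - contradiction.
  - f_equal; apply IHT; destruct H; congruence.
Qed.

Lemma unfolds_ex T : closed_styp T -> exists T', unfolds T T'.
Proof.
  remember (mus T) as n eqn:En; revert T En.
  induction n as [|n IH]; intros T En HT.
  - inversion HT; subst; simpl in *; try discriminate;
      try contradiction; eauto using unfolds.
  - destruct T; simpl in En; try discriminate.
    inversion HT; subst.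
    destruct (IH (tsubst t (TMu t T) T)) as [T' HT'].
    + rewrite mus_tsubst by auto; congruence.
    + apply closed_unfold; auto.
    + exists T'; constructor; auto.
Qed.

Lemma unfolds_closed T T' : unfolds T T' -> closed_styp T -> closed_styp T'.
Proof. induction 1; auto using closed_unfold. Qed.

Lemma unfolds_idem T T' : unfolds T T' -> unfolds T' T'.
Proof. induction 1; auto using unfolds. Qed.

Lemma closed_bra bs l S T :
  closed_styp (TBra bs) -> In (l, S, T) bs -> closed_styp S /\ closed_styp T.
Proof. intros H; inversion H; split; unfold closed_styp; eauto. Qed.

Lemma closed_sel bs l S T :
  closed_styp (TSel bs) -> In (l, S, T) bs -> closed_styp S /\ closed_styp T.
Proof. intros H; inversion H; split; unfold closed_styp; eauto. Qed.

(** * Type equality and subtyping from unfoldings *)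

(** Closed types with a common unfolding form a bisimulation: they expose the same node, and each
    child of it is related to itself. *)
Lemma unfolds_teq T T' : closed_styp T -> unfolds T T' -> teq T T'.
Proof.
  intros HT H.
  exists (fun T S => closed_styp T /\ closed_styp S /\
                     exists X, unfolds T X /\ unfolds S X).
  split; [|split; [auto|split; [eapply unfolds_closed; eauto|]];
    exists T'; split; [auto|eapply unfolds_idem; eauto]].
  clear; intros T S (HT & HS & X & H1 & H2).
  assert (Hr : forall T, closed_styp T ->
    closed_styp T /\ closed_styp T /\ exists X, unfolds T X /\ unfolds T X).
  { intros U HU; destruct (unfolds_ex U HU) as [Y HY]; eauto. }
  split; [auto|split; [auto|]]. exists X, X; split; [auto|split; [auto|]].
  pose proof (unfolds_closed _ _ H1 HT) as HX. apply unfolds_idem in H1.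
  destruct X; auto.
  - inversion HX; contradiction.
  - assert (E : forall T T', unfolds T T' -> forall t U, T' <> TMu t U).
    { induction 1; congruence. }
    destruct (E _ _ H1 t X eq_refl).
  - split; intros l U V HI; destruct (closed_bra _ _ _ _ HX HI); exists U, V; auto.
  - split; intros l U V HI; destruct (closed_sel _ _ _ _ HX HI); exists U, V; auto.
Qed.

Lemma unfolds_cases T T' :
  closed_styp T -> unfolds T T' ->
  T' = TEnd \/ (exists bs, T' = TBra bs) \/ (exists bs, T' = TSel bs).
Proof. intros HT H; induction H; eauto using closed_unfold. Qed.

(** Again children are only compared with themselves. The second alternative is what allows a
    one-label selection to be used at every selection containing that branch. *)
Lemma unfolds_sub T S T' S' :
  closed_styp T -> closed_styp S -> unfolds T T' -> unfolds S S' ->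
  T' = S' \/ (exists bs bs', T' = TSel bs /\ S' = TSel bs' /\ incl bs bs') ->
  subtype_s T S.
Proof.
  intros HT HS H1 H2 H.
  exists (fun T S => closed_styp T /\ closed_styp S /\
    exists T' S', unfolds T T' /\ unfolds S S' /\
    (T' = S' \/ (exists bs bs', T' = TSel bs /\ S' = TSel bs' /\ incl bs bs'))).
  split; [|split; [auto|split; [auto|exists T', S'; auto]]].
  clear; intros T S (HT & HS & T' & S' & H1 & H2 & H).
  split; [auto|split; [auto|]].
  pose proof (unfolds_closed _ _ H1 HT) as HT'.
  pose proof (unfolds_closed _ _ H2 HS) as HS'.
  pose proof (unfolds_teq _ _ HT H1) as E1.
  pose proof (unfolds_teq _ _ HS H2) as E2.
  assert (Hr : forall T, closed_styp T ->
    closed_styp T /\ closed_styp T /\ exists T' S', unfolds T T' /\ unfolds T S' /\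
    (T' = S' \/ (exists bs bs', T' = TSel bs /\ S' = TSel bs' /\ incl bs bs'))).
  { intros U HU; destruct (unfolds_ex U HU) as [Y HY]; eauto 10. }
  destruct H as [<-|(bs & bs' & -> & -> & Hi)].
  - destruct (unfolds_cases _ _ HT H1) as [->|[[bs ->]|[bs ->]]]; [auto|right; left|right; right];
      exists bs, bs; (split; [auto|split; [auto|]]); intros l U V HI; exists U, V.
    + destruct (closed_bra _ _ _ _ HT' HI); auto.
    + destruct (closed_sel _ _ _ _ HT' HI); auto.
  - right; right; exists bs, bs'; (split; [auto|split; [auto|]]).
    intros l U V HI; exists U, V; destruct (closed_sel _ _ _ _ HT' HI); auto.
Qed.

Lemma subtype_refl T : closed_styp T -> subtype_s T T.
Proof. intros H; destruct (unfolds_ex T H); eauto using unfolds_sub. Qed.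

(** * Duality *)

Definition dual_branch (b : label * styp * styp) : label * styp * styp :=
  let '(l, V, W) := b in (l, V, dual W).

Lemma in_dual_branch l S T bs :
  In (l, S, T) bs -> In (l, S, dual T) (map dual_branch bs).
Proof. intros H; apply (in_map dual_branch) in H; exact H. Qed.

Lemma labels_dual_branch bs : map br_label (map dual_branch bs) = map br_label bs.
Proof. rewrite map_map; apply map_ext; intros [[? ?] ?]; reflexivity. Qed.

Lemma contractive_in_dual t T : contractive_in t T -> contractive_in t (dual T).
Proof. induction T; simpl; intuition. Qed.

Lemma wf_dual ts T : wf_styp ts T -> wf_styp ts (dual T).
Proof.
  induction 1; simpl; try (constructor; auto using contractive_in_dual; fail).
  - fold dual_branch; constructor.
    + destruct bs; simpl; congruence.
    + change (NoDup (map br_label (map dual_branch bs))).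
      rewrite labels_dual_branch; auto.
    + intros l S T HI; apply in_map_iff in HI as ([[? ?] ?] & E & HI).
      injection E as <- <- <-; eauto.
    + intros l S T HI; apply in_map_iff in HI as ([[? ?] ?] & E & HI).
      injection E as <- <- <-; eauto.
  - constructor.
    + destruct bs; simpl; congruence.
    + change (NoDup (map br_label (map dual_branch bs))).
      rewrite labels_dual_branch; auto.
    + intros l S T HI; apply in_map_iff in HI as ([[? ?] ?] & E & HI).
      injection E as <- <- <-; eauto.
    + intros l S T HI; apply in_map_iff in HI as ([[? ?] ?] & E & HI).
      injection E as <- <- <-; eauto.
Qed.

Lemma closed_dual T : closed_styp T -> closed_styp (dual T).
Proof. apply wf_dual. Qed.

(** Both operations leave exchanged types alone. The induction is on well-formedness, since the
    induction principle of [styp] gives no hypothesis for the types inside a list of branches. *)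
Lemma dual_tsubst t U ts T :
  wf_styp ts T -> dual (tsubst t U T) = tsubst t (dual U) (dual T).
Proof.
  induction 1; simpl; auto.
  - destruct Nat.eq_dec; auto.
  - destruct Nat.eq_dec; simpl; congruence.
  - f_equal; rewrite !map_map; apply map_ext_in; intros [[l V] W] HI.
    rewrite (H4 _ _ _ HI); reflexivity.
  - f_equal; rewrite !map_map; apply map_ext_in; intros [[l V] W] HI.
    rewrite (H4 _ _ _ HI); reflexivity.
Qed.

Lemma unfolds_dual T T' : closed_styp T -> unfolds T T' -> unfolds (dual T) (dual T').
Proof.
  intros HT H; induction H; [apply unf_end|apply unf_sel|apply unf_bra|].
  assert (HT' := HT). inversion HT'; subst.
  apply unf_mu; fold dual. change (TMu t (dual T)) with (dual (TMu t T)).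
  erewrite <- dual_tsubst by eauto. auto using closed_unfold.
Qed.

(** * Typing up to the session environment *)

(** Subsumption compares environments pointwise and lets ended entries appear, so this one lemma
    provides both exchange and weakening by [TEnd]. *)
Lemma typed_ext Gamma P Delta Delta' :
  typed Gamma P Delta -> wf_senv Delta' -> incl Delta Delta' ->
  (forall u T, In (u, T) Delta' -> In (u, T) Delta \/ T = TEnd) ->
  typed Gamma P Delta'.
Proof.
  intros H [Hn Hc] Hi He; apply ty_sub with Delta; [auto| |split; auto].
  split; [|split].
  - intros u T S H1 H2. apply Hi in H1.
    assert (E : (u, T) = (u, S)) by (eapply NoDup_map_inj; eauto).
    injection E as ->; eauto using subtype_refl.
  - intros u T H1 []. apply Hi in H1. apply (in_map fst _ _ H1).
  - intros u T H1 H2. destruct (He _ _ H1) as [H3| ->].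
    + destruct H2; apply (in_map fst _ _ H3).
    + apply unfolds_teq; constructor.
Qed.

Lemma wf_senv_cons u T Delta :
  closed_styp T -> ~ In u (map fst Delta) -> wf_senv Delta ->
  wf_senv ((u, T) :: Delta).
Proof.
  intros H1 H2 [H3 H4]; split; simpl; [constructor; auto|].
  intros v V [E|H5]; [congruence|eauto].
Qed.

Lemma wf_senv_nil : wf_senv [].
Proof. split; [constructor|intros ? ? []]. Qed.

Lemma closed_end : closed_styp TEnd.
Proof. constructor. Qed.

(** * Inhabitants of a type, as families indexed by an identifier *)

(** One number bounds channels and variables alike, because a family is applied to a variable under
    an input and to a channel once a message has arrived. *)
Definition below (n : nat) (u : ident) : Prop :=
  match u with Chan a => a < n | Var x => x < n end.

Lemma below_neq n m u : below n u -> n <= m -> u <> Chan m /\ u <> Var m.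
Proof. destruct u; simpl; split; intros E; inversion E; lia. Qed.

Ltac senv :=
  repeat apply wf_senv_cons; auto using wf_senv_nil, closed_end;
  simpl; intuition;
  try match goal with H : _ = _ |- _ => first [congruence | injection H; lia] end.

(* The bound channels and variables of a family of level [n] are at least [n] and
   its argument is below [n]: this avoids all alpha-conversion. The process
   variable [0] is reserved for [omega]. *)
Record inhab (n : nat) (T : styp) (F : ident -> proc) : Prop := {
  inhab_typed u Gamma :
    below n u -> ~ In 0 (map fst Gamma) -> typed Gamma (F u) [(u, T)];
  inhab_wf u : wf_proc (F u);
  inhab_fc u : below n u -> incl (fc (F u)) (ident_chans u);
  inhab_bound u c : In c (bound_chans (F u)) -> n <= c;
  inhab_subst u x c :
    x < n -> subst [(x, c)] (F u) = F (subst_ident [(x, c)] u) }.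

Lemma below_le n m u : below n u -> n <= m -> below m u.
Proof. destruct u; simpl; lia. Qed.

Lemma inhab_le n m T F : inhab m T F -> n <= m -> inhab n T F.
Proof.
  intros [H1 H2 H3 H4 H5] Hl; split; eauto using below_le.
  - intros u c Hc; apply H4 in Hc; lia.
  - intros u x c Hx; apply H5; lia.
Qed.

Lemma inhab_sub n T T' F :
  subtype_s T T' -> closed_styp T' -> inhab n T F -> inhab n T' F.
Proof.
  intros HS HT [H1 H2 H3 H4 H5]; split; auto.
  intros u Gamma Hu HG; apply ty_sub with [(u, T)]; auto.
  - split; [|split]; simpl.
    + intros v V W [E|[]] [E'|[]]; congruence.
    + intros v V [E|[]] []; left; congruence.
    + intros v V [E|[]] []; left; congruence.
  - senv.
Qed.

(* Inhabits every session type: it keeps forwarding its channel to itself over a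
   fresh session, the input prefix of which guards the recursive call. *)
Definition omega (n : nat) (u : ident) : proc :=
  PDef 0 [n]
    (PRes n (S n)
      (PPar (POut (Chan n) 0 (Var n) PNil)
            (PIn (Chan (S n)) [(0, S n, PCall 0 [Var (S n)])])))
    (PCall 0 [u]).

Lemma closed_msg (l : label) S T :
  closed_styp S -> closed_styp T ->
  closed_styp (TSel [(l, S, T)]) /\ closed_styp (TBra [(l, S, T)]).
Proof.
  intros HS HT; split; constructor; try discriminate;
    try (repeat constructor; simpl; tauto);
    intros ? ? ? [E|[]]; injection E as <- <- <-; auto.
Qed.

Lemma drop_vars_other x y c : x <> y -> drop_vars [y] [(x, c)] = [(x, c)].
Proof. intros H; unfold drop_vars; simpl; destruct (Nat.eqb_spec x y); tauto. Qed.

Lemma subst_ident_other x y c : x <> y -> subst_ident [(x, c)] (Var y) = Var y.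
Proof. intros H; simpl; destruct Nat.eq_dec; congruence. Qed.

Lemma subst_ident_same x c : subst_ident [(x, c)] (Var x) = Chan c.
Proof. simpl; destruct Nat.eq_dec; congruence. Qed.

Lemma omega_inhab n T : closed_styp T -> inhab n T (omega n).
Proof.
  intros HT. destruct (closed_msg 0 T TEnd HT closed_end) as [Hs Hb].
  split.
  - intros u Gamma Hu HG. apply ty_def with [T]; auto.
    (* The private session carries a single message of type [T], so the recursive call behind the
       input again receives a channel of type [T]. *)
    + simpl. eapply ty_res with (T := TSel [(0, T, TEnd)]).
      apply typed_ext with
        ([(Chan n, TSel [(0, T, TEnd)]); (Var n, T)] ++
         [(Chan (S n), TBra [(0, T, TEnd)])]).
      * apply ty_par.
        -- apply ty_out; [|senv].
           apply typed_ext with []; [constructor|senv|intros ? []|].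
           intros v V [E|[]]; injection E; auto.
        -- apply ty_in; [reflexivity| |senv].
           intros l x P S0 T0 [E|[]] [E'|[]].
           injection E as <- <- <-; injection E' as <- <-.
           apply typed_ext with (combine [Var (S n)] [T]).
           ++ apply ty_call; simpl; auto; senv.
           ++ senv.
           ++ intros p [<-|[]]; simpl; auto.
           ++ simpl; intros v V [E|[E|[]]]; injection E; auto.
        -- senv.
      * simpl; senv.
      * intros p; simpl; tauto.
      * simpl; tauto.
    + apply (ty_call ((0, [T]) :: Gamma) 0 [T] [u]); simpl; auto; senv.
  - intros u; apply wfp_def; simpl; auto using wf_proc.
    + repeat constructor; simpl; tauto.
    + apply wfp_res; [lia|]. apply wfp_par; [auto using wf_proc|].
      apply wfp_in; [discriminate|repeat constructor; simpl; tauto|].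
      intros l x P [E|[]]; injection E as <- <- <-; constructor.
  - intros u Hu; unfold omega, remove_all; simpl.
    rewrite !Nat.eqb_refl; simpl. rewrite !Bool.orb_true_r; simpl.
    rewrite app_nil_r; apply incl_refl.
  - intros u c; unfold omega; simpl; lia.
  (* The variables bound in the body are [n] and [S n], both different from [x], so only the
     argument of the call is affected. *)
  - intros u x c Hx; unfold omega; cbn [subst map].
    rewrite !drop_vars_other by lia. rewrite !subst_ident_other by lia. reflexivity.
Qed.

(** * Inhabitants of selections and branchings *)

(** The message is one endpoint of a fresh session whose other endpoint is kept by [B]: this is how
    an error can later move to the exchanged channel. Since [n] and [S n] are taken, [A] and [B] are
    used at level [2 + n]. *)
Definition sender (n : nat) (l : label) (A B : ident -> proc) (u : ident) : proc :=
  PRes n (S n) (PPar (POut u l (Chan n) (A u)) (B (Chan (S n)))).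

(** Only the branch [l0] lies on the path to the error: there [D] continues the session and [E] uses
    the received channel. [omega] fills in the other branches whatever their types are. *)
Definition receiver (n : nat) (l0 : label) (D E : ident -> proc)
    (ts : list (label * styp * styp)) (u : ident) : proc :=
  PIn u (map (fun b => (br_label b, n,
           if Nat.eq_dec (br_label b) l0 then PPar (D u) (E (Var n))
           else PPar (omega (2 + n) u) (omega (2 + n) (Var n)))) ts).

Lemma sender_inhab n l A B S1 T1 :
  inhab (2 + n) T1 A -> inhab (2 + n) (dual S1) B ->
  closed_styp S1 -> closed_styp T1 ->
  inhab n (TSel [(l, S1, T1)]) (sender n l A B).
Proof.
  intros HA HB HS HT. destruct (closed_msg l S1 T1 HS HT) as [Hs _].
  pose proof (closed_dual _ HS) as HS'.
  split.
  - intros u Gamma Hu HG.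
    destruct (below_neq n n u Hu (le_n _)), (below_neq n (S n) u Hu) as []; auto.
    (* [S1] types the endpoint sent away, which leaves [dual S1] for [B]. *)
    apply ty_res with S1.
    apply typed_ext with ([(u, TSel [(l, S1, T1)]); (Chan n, S1)] ++
                          [(Chan (S n), dual S1)]).
    + apply ty_par.
      * apply ty_out; [|senv]. apply (inhab_typed _ _ _ HA); auto.
        apply below_le with n; auto; lia.
      * apply (inhab_typed _ _ _ HB); simpl; auto; lia.
      * senv.
    + senv.
    + intros p; simpl; tauto.
    + simpl; tauto.
  - intros u; apply wfp_res; [lia|].
    apply wfp_par; [apply wfp_out|]; [apply (inhab_wf _ _ _ HA)|apply (inhab_wf _ _ _ HB)].
  - intros u Hu c Hc. unfold sender in Hc; cbn [fc] in Hc.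
    apply filter_In in Hc as [Hc Hn].
    apply Bool.negb_true_iff in Hn; simpl in Hn.
    rewrite !Bool.orb_false_iff in Hn.
    rewrite !Nat.eqb_neq in Hn.
    rewrite !in_app_iff in Hc. simpl in Hc.
    destruct Hc as [[Hc|[Hc|Hc]]|Hc]; auto; try lia.
    + apply (inhab_fc _ _ _ HA) in Hc; auto. apply below_le with n; auto; lia.
    + apply (inhab_fc _ _ _ HB) in Hc; simpl in *; lia.
  - intros u c; unfold sender; simpl; rewrite in_app_iff.
    intros [Hc|[Hc|[Hc|Hc]]]; try lia.
    + apply (inhab_bound _ _ _ HA) in Hc; lia.
    + apply (inhab_bound _ _ _ HB) in Hc; lia.
  - intros u x c Hx; unfold sender; cbn [subst].
    rewrite (inhab_subst _ _ _ HA), (inhab_subst _ _ _ HB) by lia. reflexivity.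
Qed.

Lemma par_inhab n T U D E Gamma u v :
  inhab n T D -> inhab n U E -> closed_styp T -> closed_styp U ->
  below n u -> below n v -> u <> v -> ~ In 0 (map fst Gamma) ->
  typed Gamma (PPar (D u) (E v)) [(v, U); (u, T)].
Proof.
  intros HD HE HT HU Hu Hv Hn HG.
  apply typed_ext with ([(u, T)] ++ [(v, U)]).
  - apply ty_par; [apply (inhab_typed _ _ _ HD)|apply (inhab_typed _ _ _ HE)|]; auto.
    senv.
  - senv.
  - intros p; simpl; tauto.
  - simpl; tauto.
Qed.

Lemma receiver_inhab n l0 D E ts S0 T0 :
  closed_styp (TBra ts) -> In (l0, S0, T0) ts ->
  inhab (2 + n) T0 D -> inhab (2 + n) S0 E ->
  inhab n (TBra ts) (receiver n l0 D E ts).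
Proof.
  intros Hc H0 HD HE. assert (ts <> [] /\ NoDup (map br_label ts)) as [Hne Hnd]
    by (inversion Hc; auto).
  assert (Hl : forall F, map in_label
     (map (fun b => (br_label b, n, F b)) ts) = map br_label ts).
  { intros F; rewrite map_map; reflexivity. }
  assert (Hom : forall l V W, In (l, V, W) ts ->
    inhab (2 + n) W (omega (2 + n)) /\ inhab (2 + n) V (omega (2 + n))).
  { intros l V W HI; destruct (closed_bra _ _ _ _ Hc HI).
    split; apply omega_inhab; auto. }
  split.
  - intros u Gamma Hu HG.
    destruct (below_neq n n u Hu (le_n _)).
    apply ty_in; [apply Hl| |senv].
    intros l x P V W Hb HI.
    apply in_map_iff in Hb as (b & Eb & Hb). injection Eb as <- <- <-.
    (* Labels being distinct, the entry of [ts] paired with this input branch is the one it was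
       built from. Likewise, a branch labelled [l0] must have the types of [D] and [E]. *)
    assert (b = (br_label b, V, W)) as Eb by (eapply NoDup_map_inj; eauto).
    destruct (closed_bra _ _ _ _ Hc HI), (Hom _ _ _ HI) as [].
    assert (below (2 + n) u) by (apply below_le with n; auto; lia).
    destruct Nat.eq_dec as [El|_].
    + assert ((br_label b, V, W) = (l0, S0, T0)) as Eb'
        by (eapply NoDup_map_inj; eauto).
      injection Eb' as _ -> ->.
      apply par_inhab with (2 + n); simpl; auto; lia.
    + apply par_inhab with (2 + n); simpl; auto; lia.
  - intros u; apply wfp_in.
    + destruct ts; simpl; congruence.
    + rewrite Hl; auto.
    + intros l x P H1.
      apply in_map_iff in H1 as ([[l' V] W] & Eb & H1). injection Eb as <- <- <-.
      destruct (Hom _ _ _ H1) as [Hom1 Hom2].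
      destruct Nat.eq_dec; apply wfp_par; eapply inhab_wf; eauto.
  - intros u Hu c H1. unfold receiver in H1; cbn [fc] in H1.
    assert (Hu' : below (2 + n) u) by (apply below_le with n; auto; lia).
    apply in_app_iff in H1 as [H1|H1]; auto.
    apply in_flat_map in H1 as (p & H1 & H2).
    apply in_map_iff in H1 as ([[l V] W] & <- & H1).
    destruct (Hom _ _ _ H1) as [Hom1 Hom2].
    destruct Nat.eq_dec; cbn [fc] in H2; apply in_app_iff in H2 as [H2|H2].
    + apply (inhab_fc _ _ _ HD) in H2; auto.
    + apply (inhab_fc _ _ _ HE) in H2; simpl in *; [tauto|lia].
    + apply (inhab_fc _ _ _ Hom1) in H2; auto.
    + apply (inhab_fc _ _ _ Hom2) in H2; simpl in *; [tauto|lia].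
  - intros u c H1. unfold receiver in H1; cbn [bound_chans] in H1.
    apply in_flat_map in H1 as (p & H1 & H2).
    apply in_map_iff in H1 as ([[l V] W] & <- & H1).
    destruct (Hom _ _ _ H1) as [Hom1 Hom2].
    destruct Nat.eq_dec; cbn [bound_chans] in H2; apply in_app_iff in H2 as [H2|H2].
    + apply (inhab_bound _ _ _ HD) in H2; lia.
    + apply (inhab_bound _ _ _ HE) in H2; lia.
    + apply (inhab_bound _ _ _ Hom1) in H2; lia.
    + apply (inhab_bound _ _ _ Hom2) in H2; lia.
  - intros u x c Hx; unfold receiver; cbn [subst]; f_equal.
    rewrite map_map; apply map_ext_in; intros [[l V] W] H1.
    destruct (Hom _ _ _ H1) as [Hom1 Hom2].
    rewrite drop_vars_other by lia. f_equal.
    destruct Nat.eq_dec; cbn [subst].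
    + rewrite (inhab_subst _ _ _ HD), (inhab_subst _ _ _ HE) by lia.
      rewrite subst_ident_other by lia. reflexivity.
    + rewrite (inhab_subst _ _ _ Hom1), (inhab_subst _ _ _ Hom2) by lia.
      rewrite subst_ident_other by lia. reflexivity.
Qed.

(** * Reduction to [PErr] under congruence and in contexts *)

Lemma scong_reds P P' : scong P P' -> reds_s P' PErr -> reds_s P PErr.
Proof.
  intros H HR.
  assert (Hs : forall Q, red_s P' Q -> red_s P Q).
  { intros Q HQ; apply red_scong with P' Q; auto; apply congr_refl. }
  apply clos_rt_rt1n in HR; inversion HR as [|Q R HQ HR']; subst.
  (* With zero steps [P] is merely congruent to [PErr]; the error rule in the empty context supplies
     a step from [PErr] to itself that can absorb the congruence. *)
  - apply rt_step, Hs, (red_err_ctx CHole).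
  - apply rt_trans with Q; [apply rt_step; auto|apply clos_rt1n_rt; auto].
Qed.

Lemma reds_fill C P P' : reds_s P P' -> reds_s (fill C P) (fill C P').
Proof.
  induction 1; [apply rt_step, red_ctx; auto|apply rt_refl|eapply rt_trans; eauto].
Qed.

Lemma reds_fill_err C P : reds_s P PErr -> reds_s (fill C P) PErr.
Proof.
  intros H; apply rt_trans with (fill C PErr); [apply reds_fill; auto|].
  apply rt_step, red_err_ctx.
Qed.

Lemma step_reds P Q : red_s P Q -> reds_s Q PErr -> reds_s P PErr.
Proof. intros H; apply rt_trans, rt_step, H. Qed.

Lemma scong_par_comm P Q : scong (PPar P Q) (PPar Q P).
Proof. apply congr_base, sc_par_comm. Qed.

Lemma scong_par_assoc P Q R : scong (PPar (PPar P Q) R) (PPar P (PPar Q R)).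
Proof. apply congr_base, sc_par_assoc. Qed.

Lemma scong_par_swap P Q R : scong (PPar (PPar P Q) R) (PPar (PPar P R) Q).
Proof.
  eapply congr_trans; [apply scong_par_assoc|].
  eapply congr_trans; [|apply congr_sym, scong_par_assoc].
  apply congr_par; [apply congr_refl|apply scong_par_comm].
Qed.

Lemma scong_res_comm a b P Q :
  scong (PRes a b (PPar P Q)) (PRes b a (PPar Q P)).
Proof.
  eapply congr_trans; [apply congr_base, sc_res_sym|].
  apply congr_res, scong_par_comm.
Qed.

(** [R] enters the inner restriction, the two restrictions are exchanged, and [Q] leaves the scope
    of [a] and [b]. This puts [P] face to face with [R], ready to interact. *)
Lemma scong_extrude a b c d P Q R :
  ~ In c (fc R) -> ~ In d (fc R) -> ~ In a (fc Q) -> ~ In b (fc Q) ->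
  a <> c -> a <> d -> b <> c -> b <> d ->
  scong (PRes a b (PPar (PRes c d (PPar P Q)) R))
        (PRes c d (PPar (PRes a b (PPar P R)) Q)).
Proof.
  intros.
  eapply congr_trans; [apply congr_res, congr_base, sc_res_par; auto|].
  eapply congr_trans; [apply congr_base, sc_res_res; auto|].
  apply congr_res.
  eapply congr_trans; [apply congr_res, scong_par_swap|].
  apply congr_sym, congr_base, sc_res_par; auto.
Qed.

(** * Conflicting families and the effect of one communication *)

(** With all endpoints below the level covered, a conflict at level [2 + n] applies both to the
    original session and to the fresh pair [n], [S n]. *)
Definition conflict (n : nat) (P Q : ident -> proc) : Prop :=
  forall a b, a < n -> b < n -> a <> b ->
    reds_s (PRes a b (PPar (P (Chan a)) (Q (Chan b)))) PErr.

Lemma conflict_sym n P Q : conflict n P Q -> conflict n Q P.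
Proof.
  intros H a b Ha Hb Hab.
  eapply scong_reds; [apply scong_res_comm|]. apply H; auto.
Qed.

Lemma fc_chan_other m T F a c :
  inhab m T F -> a < m -> a <> c -> ~ In c (fc (F (Chan a))).
Proof.
  intros HF Ha Hc HI. apply (inhab_fc _ _ _ HF) in HI; simpl in *; intuition.
Qed.

Lemma sender_reds n l A B S1 R a b :
  inhab (2 + n) (dual S1) B -> a < n -> b < n ->
  ~ In n (fc R) -> ~ In (S n) (fc R) ->
  reds_s (PRes a b (PPar (POut (Chan a) l (Chan n) (A (Chan a))) R)) PErr ->
  reds_s (PRes a b (PPar (sender n l A B (Chan a)) R)) PErr.
Proof.
  intros HB Ha Hb H1 H2 H.
  eapply scong_reds.
  - apply scong_extrude; auto; try lia; eapply fc_chan_other; eauto; lia.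
  - exact (reds_fill_err (CRes n (S n) (CPar CHole (B (Chan (S n))))) _ H).
Qed.

(** After the message [l], [A] faces [D] on the original session and [E] faces [B] on the fresh one;
    a conflict on either produces the error. *)
Lemma com_conflict n l A B D E ts S1 T1 S2 T2 :
  inhab (2 + n) T1 A -> inhab (2 + n) (dual S1) B ->
  inhab (2 + n) T2 D -> inhab (2 + n) S2 E ->
  closed_styp (TBra ts) -> In (l, S2, T2) ts ->
  conflict (2 + n) A D \/ conflict (2 + n) E B ->
  conflict n (sender n l A B) (receiver n l D E ts).
Proof.
  intros HA HB HD HE Hc HI H a b Ha Hb Hab.
  assert (HR : inhab n (TBra ts) (receiver n l D E ts))
    by (eapply receiver_inhab; eauto).
  eapply scong_reds.
  { apply scong_extrude; try lia; eapply fc_chan_other; eauto; lia. }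
  eapply step_reds.
  { apply (red_ctx (CRes n (S n) (CPar CHole (B (Chan (S n)))))).
    (* The number [n] is both the channel sent and the bound variable of the input; being below
       [2 + n], it meets no binder of [D] or [E]. *)
    apply red_com with (x := n) (Q := PPar (D (Chan b)) (E (Var n))).
    - apply in_map_iff; exists (l, S2, T2); split; auto.
      unfold br_label; simpl. destruct Nat.eq_dec; [reflexivity|tauto].
    - cbn [bound_chans]; rewrite in_app_iff; intros [HI'|HI'].
      + apply (inhab_bound _ _ _ HD) in HI'; lia.
      + apply (inhab_bound _ _ _ HE) in HI'; lia. }
  cbn [subst fill]. rewrite (inhab_subst _ _ _ HD), (inhab_subst _ _ _ HE) by lia.
  rewrite subst_ident_same.
  change (subst_ident [(n, n)] (Chan b)) with (Chan b).
  assert (Hs : scong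
    (PRes a b (PPar (A (Chan a)) (PPar (D (Chan b)) (E (Chan n)))))
    (PPar (PRes a b (PPar (A (Chan a)) (D (Chan b)))) (E (Chan n)))).
  { eapply congr_trans; [apply congr_res, congr_sym, scong_par_assoc|].
    apply congr_sym, congr_base, sc_res_par; eapply fc_chan_other; eauto; lia. }
  eapply scong_reds; [apply congr_res, congr_par; [apply Hs|apply congr_refl]|].
  destruct H as [H|H].
  - apply (reds_fill_err (CRes n (S n)
      (CPar (CPar CHole (E (Chan n))) (B (Chan (S n)))))).
    apply H; lia.
  (* The failing session is now [n], [S n]: [E] is grouped with [B], and the remaining [A] and [D]
     are moved out of the restriction. *)
  - eapply scong_reds.
    + eapply congr_trans; [apply congr_res|].
      * eapply congr_trans; [apply scong_par_assoc|apply scong_par_comm].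
      * apply congr_sym, congr_base, sc_res_par; intros HI';
          apply filter_In in HI' as [HI' _]; apply in_app_iff in HI' as [HI'|HI'];
          revert HI'; eapply fc_chan_other; eauto; lia.
    + eapply (reds_fill_err (CPar CHole _)). apply H; lia.
Qed.

(** * Clashing types *)

(** Requiring every level makes a clash of components available at level [2 + n], inside a sender
    and a receiver of level [n]. *)
Definition clash (T U : styp) : Prop :=
  forall n, exists P Q, inhab n T P /\ inhab n U Q /\ conflict n P Q.

Lemma clash_sym T U : clash T U -> clash U T.
Proof.
  intros H n; destruct (H n) as (P & Q & HP & HQ & HPQ).
  exists Q, P; auto using conflict_sym.
Qed.

Lemma sender_sub n l A B bs S1 T1 T :
  closed_styp T -> unfolds T (TSel bs) -> In (l, S1, T1) bs ->
  inhab (2 + n) T1 A -> inhab (2 + n) (dual S1) B ->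
  inhab n T (sender n l A B).
Proof.
  intros HT Hu HI HA HB.
  pose proof (unfolds_closed _ _ Hu HT) as Hb.
  destruct (closed_sel _ _ _ _ Hb HI) as [HS1 HT1].
  destruct (closed_msg l _ _ HS1 HT1) as [Hm _].
  apply inhab_sub with (TSel [(l, S1, T1)]); auto using sender_inhab.
  eapply unfolds_sub; eauto using unfolds.
  right; do 2 eexists; split; [|split]; eauto. intros p [<-|[]]; auto.
Qed.

Lemma receiver_sub n l D E ts S0 T0 U :
  closed_styp U -> unfolds U (TBra ts) -> In (l, S0, T0) ts ->
  inhab (2 + n) T0 D -> inhab (2 + n) S0 E ->
  inhab n U (receiver n l D E ts).
Proof.
  intros HU Hu HI HD HE.
  pose proof (unfolds_closed _ _ Hu HU) as Hb.
  apply inhab_sub with (TBra ts); auto; [|eapply receiver_inhab; eauto].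
  eapply unfolds_sub; eauto using unfolds.
Qed.

(** The clashing components supply two of the four continuations and [omega] the other two. An
    exchange clash opposes [S2], expected by the receiver, to [dual S1], the type of the endpoint
    kept by the sender. *)
Lemma clash_com T U bs ts l S1 T1 S2 T2 :
  closed_styp T -> closed_styp U ->
  unfolds T (TSel bs) -> unfolds U (TBra ts) ->
  In (l, S1, T1) bs -> In (l, S2, T2) ts ->
  clash T1 T2 \/ clash S2 (dual S1) -> clash T U.
Proof.
  intros HT HU HuT HuU HI1 HI2 H n.
  pose proof (unfolds_closed _ _ HuT HT) as Hb.
  pose proof (unfolds_closed _ _ HuU HU) as Hts.
  destruct (closed_sel _ _ _ _ Hb HI1) as [HS1 HT1].
  destruct (closed_bra _ _ _ _ Hts HI2) as [HS2 HT2].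
  assert (exists A B D E,
    inhab (2 + n) T1 A /\ inhab (2 + n) (dual S1) B /\
    inhab (2 + n) T2 D /\ inhab (2 + n) S2 E /\
    (conflict (2 + n) A D \/ conflict (2 + n) E B))
    as (A & B & D & E & HA & HB & HD & HE & HC).
  { destruct H as [H|H]; destruct (H (2 + n)) as (P & Q & HP & HQ & HPQ).
    - exists P, (omega (2 + n)), Q, (omega (2 + n));
        auto 10 using omega_inhab, closed_dual.
    - exists (omega (2 + n)), Q, (omega (2 + n)), P;
        auto 10 using omega_inhab, closed_dual. }
  exists (sender n l A B), (receiver n l D E ts).
  split; [eapply sender_sub; eauto|split; [eapply receiver_sub; eauto|]].
  eapply com_conflict; eauto.
Qed.

(** * Immediate mismatches between the heads of two types *)

Lemma sel_head bs :
  closed_styp (TSel bs) -> exists l S T, In (l, S, T) bs.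
Proof.
  intros H; destruct bs as [|[[l S] T] bs]; [inversion H; contradiction|].
  exists l, S, T; left; reflexivity.
Qed.

Lemma bra_head bs :
  closed_styp (TBra bs) -> exists l S T, In (l, S, T) bs.
Proof.
  intros H; destruct bs as [|[[l S] T] bs]; [inversion H; contradiction|].
  exists l, S, T; left; reflexivity.
Qed.

Lemma sender_omega n l bs S1 T1 T :
  closed_styp T -> unfolds T (TSel bs) -> In (l, S1, T1) bs ->
  inhab n T (sender n l (omega (2 + n)) (omega (2 + n))) /\
  inhab (2 + n) T1 (omega (2 + n)) /\ inhab (2 + n) (dual S1) (omega (2 + n)).
Proof.
  intros HT Hu HI. pose proof (unfolds_closed _ _ Hu HT) as Hb.
  destruct (closed_sel _ _ _ _ Hb HI) as [HS1 HT1].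
  split; [|auto using omega_inhab, closed_dual].
  apply sender_sub with bs S1 T1; auto using omega_inhab, closed_dual.
Qed.

Lemma nil_inhab n T : closed_styp T -> unfolds T TEnd -> inhab n T (fun _ => PNil).
Proof.
  intros HT Hu.
  apply inhab_sub with TEnd; eauto using unfolds_sub, unfolds, closed_end.
  split.
  - intros u Gamma _ _; apply typed_ext with []; [constructor|senv|intros ? []|].
    simpl; intros v V [E|[]]; injection E; auto.
  - constructor.
  - intros u _ ? [].
  - intros u c [].
  - reflexivity.
Qed.

Lemma orphan_conflict n T F :
  inhab n T F -> (forall a, a < n -> In a (sc (F (Chan a)))) ->
  conflict n F (fun _ => PNil).
Proof.
  intros HF Hs a b Ha Hb Hab; apply rt_step, red_err_orphan; simpl;
    rewrite in_app_iff; simpl; auto.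
  intros [HI|[]]; revert HI; eapply fc_chan_other; eauto.
Qed.

(** The ended side is inhabited by [PNil], which does not mention its endpoint, whereas the other
    side has its own endpoint as a subject: the orphan rule fires. *)
Lemma clash_end T U U' :
  closed_styp T -> closed_styp U -> unfolds T TEnd -> unfolds U U' -> U' <> TEnd ->
  clash U T.
Proof.
  intros HT HU HuT HuU Hne n.
  pose proof (unfolds_closed _ _ HuU HU) as Hb.
  destruct (unfolds_cases _ _ HU HuU) as [->|[[bs ->]|[bs ->]]]; [congruence| |].
  - destruct (bra_head _ Hb) as (l & V & W & HI), (closed_bra _ _ _ _ Hb HI).
    exists (receiver n l (omega (2 + n)) (omega (2 + n)) bs), (fun _ => PNil).
    assert (HR : inhab n U (receiver n l (omega (2 + n)) (omega (2 + n)) bs))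
      by (eapply receiver_sub; eauto using omega_inhab).
    split; [exact HR|split; [auto using nil_inhab|]].
    eapply orphan_conflict; [exact HR|]. simpl; auto.
  - destruct (sel_head _ Hb) as (l & V & W & HI).
    destruct (sender_omega n l bs V W U) as [HS _]; auto.
    exists (sender n l (omega (2 + n)) (omega (2 + n))), (fun _ => PNil).
    split; [exact HS|split; [auto using nil_inhab|]].
    eapply orphan_conflict; [exact HS|].
    (* The subject [a] survives the restriction of [n] and [S n], being below [n]. *)
    intros a Ha; unfold sender; cbn [sc]; apply filter_In; split; [simpl; auto|].
    simpl. apply Bool.negb_true_iff; rewrite !Bool.orb_false_iff, !Nat.eqb_neq; lia.
Qed.

Lemma clash_in T U bs ts :
  closed_styp T -> closed_styp U -> unfolds T (TBra bs) -> unfolds U (TBra ts) ->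
  clash T U.
Proof.
  intros HT HU HuT HuU n.
  pose proof (unfolds_closed _ _ HuT HT) as Hb.
  pose proof (unfolds_closed _ _ HuU HU) as Hts.
  destruct (bra_head _ Hb) as (l & V & W & HI), (closed_bra _ _ _ _ Hb HI).
  destruct (bra_head _ Hts) as (l' & V' & W' & HI'), (closed_bra _ _ _ _ Hts HI').
  exists (receiver n l (omega (2 + n)) (omega (2 + n)) bs).
  exists (receiver n l' (omega (2 + n)) (omega (2 + n)) ts).
  split; [|split]; [eapply receiver_sub; eauto using omega_inhab..|].
  intros a b _ _ _. apply rt_step, red_err_in.
Qed.

Lemma clash_out T U bs ts :
  closed_styp T -> closed_styp U -> unfolds T (TSel bs) -> unfolds U (TSel ts) ->
  clash T U.
Proof.
  intros HT HU HuT HuU n.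
  pose proof (unfolds_closed _ _ HuT HT) as Hb.
  pose proof (unfolds_closed _ _ HuU HU) as Hts.
  destruct (sel_head _ Hb) as (l & V & W & HI), (sel_head _ Hts) as (l' & V' & W' & HI').
  destruct (sender_omega n l bs V W T) as (HS & HA & HB); auto.
  (* The second sender is built two levels higher so that the fresh channels of the two senders
     differ; it is then viewed at level [n] by [inhab_le]. *)
  destruct (sender_omega (2 + n) l' ts V' W' U) as (HS' & HA' & HB'); auto.
  eexists _, _; split; [exact HS|split; [eapply inhab_le; [exact HS'|lia]|]].
  intros a b Ha Hb' Hab.
  eapply sender_reds; eauto; try (eapply fc_chan_other; eauto; lia).
  eapply scong_reds; [apply scong_res_comm|].
  eapply sender_reds; eauto; try lia;
    try (cbn [fc ident_chans app In]; intros [E|[E|HI2]]; try lia;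
         revert HI2; eapply fc_chan_other; eauto; lia).
  apply rt_step, red_err_out.
Qed.

(** The error arises at the first message, so the receiver may single out an arbitrary branch [l']
    and run [omega] in all of them. *)
Lemma clash_label T U bs ts l S1 T1 :
  closed_styp T -> closed_styp U -> unfolds T (TSel bs) -> unfolds U (TBra ts) ->
  In (l, S1, T1) bs -> ~ In l (map br_label ts) ->
  clash T U.
Proof.
  intros HT HU HuT HuU HI Hl n.
  pose proof (unfolds_closed _ _ HuU HU) as Hts.
  destruct (bra_head _ Hts) as (l' & V' & W' & HI'), (closed_bra _ _ _ _ Hts HI').
  destruct (sender_omega n l bs S1 T1 T) as (HS & HA & HB); auto.
  assert (HR : inhab n U (receiver n l' (omega (2 + n)) (omega (2 + n)) ts))
    by (eapply receiver_sub; eauto using omega_inhab).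
  eexists _, _; split; [exact HS|split; [exact HR|]].
  intros a b Ha Hb Hab.
  eapply sender_reds; eauto; try (eapply fc_chan_other; eauto; lia).
  apply rt_step, red_err_label.
  rewrite map_map; exact Hl.
Qed.

Lemma in_labels l (bs : list (label * styp * styp)) :
  In l (map br_label bs) -> exists S T, In (l, S, T) bs.
Proof.
  intros H; apply in_map_iff in H as ([[l' S] T] & <- & H); exists S, T; exact H.
Qed.

(** * The subtyping simulation and completeness *)

(** Among the nine pairs of heads, those that differ clash at once. Matching heads must agree on
    labels, and by [clash_com] a clash between components would propagate to the whole types. *)
Lemma no_clash_sim :
  sub_sim (fun T S => closed_styp T /\ closed_styp S /\ ~ clash T (dual S)).
Proof.
  intros T S (HT & HS & HC); split; [auto|split; [auto|]].
  destruct (unfolds_ex _ HT) as [T' HuT], (unfolds_ex _ HS) as [S' HuS].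
  pose proof (unfolds_closed _ _ HuT HT) as HT'.
  pose proof (unfolds_closed _ _ HuS HS) as HS'.
  pose proof (unfolds_teq _ _ HT HuT) as ET.
  pose proof (unfolds_teq _ _ HS HuS) as ES.
  pose proof (unfolds_dual _ _ HS HuS) as HuD.
  pose proof (closed_dual _ HS) as HD.
  destruct (unfolds_cases _ _ HT HuT) as [->|[[bs ->]|[bs ->]]],
    (unfolds_cases _ _ HS HuS) as [->|[[ts ->]|[ts ->]]]; auto.
  - destruct HC; apply clash_sym; eapply clash_end; eauto; discriminate.
  - destruct HC; apply clash_sym; eapply clash_end; eauto; discriminate.
  - destruct HC; eapply clash_end; eauto; discriminate.
  (* Here [dual S] is the sending side, so the clash lemmas apply to the swapped pair. *)
  - right; left; exists bs, ts; split; [auto|split; [auto|]].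
    intros l S1' T1' HI.
    destruct (closed_bra _ _ _ _ HS' HI).
    change (dual (TBra ts)) with (TSel (map dual_branch ts)) in HuD.
    apply in_dual_branch in HI.
    destruct (classic (In l (map br_label bs))) as [Hl|Hl];
      [|destruct HC; apply clash_sym; eapply clash_label; eauto].
    apply in_labels in Hl as (S1 & T1 & HI').
    destruct (closed_bra _ _ _ _ HT' HI').
    exists S1, T1; split; [auto|].
    split; (split; [auto|split; [auto|]]); intros Hc; destruct HC;
      apply clash_sym; eapply clash_com; eauto using clash_sym.
  - destruct HC; eapply clash_in; eauto.
  - destruct HC; eapply clash_end; eauto; discriminate.
  - destruct HC; eapply clash_out; eauto.
  (* Here [T] sends: an exchange clash opposes [S1'] to [dual S1], which is exactly the
     contravariant requirement on exchanged types. *)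
  - right; right; exists bs, ts; split; [auto|split; [auto|]].
    intros l S1 T1 HI.
    destruct (closed_sel _ _ _ _ HT' HI).
    change (dual (TSel ts)) with (TBra (map dual_branch ts)) in HuD.
    destruct (classic (In l (map br_label ts))) as [Hl|Hl];
      [|destruct HC; eapply clash_label; eauto; rewrite labels_dual_branch; auto].
    apply in_labels in Hl as (S1' & T1' & HI').
    destruct (closed_sel _ _ _ _ HS' HI').
    exists S1', T1'; split; [auto|].
    apply in_dual_branch in HI'.
    split; (split; [auto|split; [auto|]]); intros Hc; destruct HC;
      eapply clash_com; eauto.
Qed.

Theorem theorem3p4 (T S : styp) (a : chan)
    (hT : closed_styp T) (hS : closed_styp S) :
  ~ (exists (C : ctx) (P : proc),
       wf_ctx C /\ wf_proc P /\
       ctx_typed C a S /\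
       typed [] P [(Chan a, T)] /\
       reds_s (fill C P) PErr) ->
  subtype_s T S.
Proof.
  intros H. eexists; split; [exact no_clash_sim|].
  split; [auto|split; [auto|]]. intros HC; apply H.
  (* Level [2 + a] leaves room for both [a] and its co-channel [1 + a]. *)
  destruct (HC (2 + a)) as (P & Q & HP & HQ & HPQ).
  set (b := 1 + a).
  exists (CRes a b (CPar CHole (Q (Chan b)))), (P (Chan a)).
  split; [|split; [|split; [|split]]].
  - split; [unfold b; lia|split; [exact I|apply (inhab_wf _ _ _ HQ)]].
  - apply (inhab_wf _ _ _ HP).
  (* The successor of the maximum is fresh for the context, and it is not [0], the process variable
     reserved for [omega]. *)
  - exists (1 + list_max (pvars (Q (Chan b)))); split.
    + simpl; intros HI.
      assert (Hm := proj1 (list_max_le _ _) (le_n (list_max (pvars (Q (Chan b)))))).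
      rewrite Forall_forall in Hm; apply Hm in HI; lia.
    + pose proof (closed_dual _ hS) as hD.
      simpl; apply ty_res with S.
      apply (ty_par _ _ _ [(Chan a, S)] [(Chan b, dual S)]).
      * apply (ty_call _ _ [S] [Chan a]); simpl; auto; senv.
      * apply (inhab_typed _ _ _ HQ); simpl; unfold b; lia.
      * unfold b; senv.
  - apply (inhab_typed _ _ _ HP); simpl; auto; lia.
  - apply HPQ; unfold b; lia.
Qed.
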